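(* Let $V_\epsilon(x)=V_0(x)+V_1(x,x/\epsilon)$, $\epsilon>0$, be a multiscale potential on $\mathbb{R}^n$ as in the context, and assume that $V_1$ has bounded oscillation uniformly in $\epsilon$, i.e. $\operatorname{osc}V_1=\sup_x V_1(x,x/\epsilon)-\inf_x V_1(x,x/\epsilon)$ is bounded by a finite constant independent of $\epsilon$. Suppose the sampling strategy uses a proposal kernel $q(x\to y)$ that does not depend on $\epsilon$, with either the Metropolis or the Barker acceptance rule. Let $\mathcal{T}_\epsilon$ be the transition operator of the chain with proposals $q$ sampling $\mu$, and $\mathcal{T}_0$ the transition operator of the chain with proposals $q$ (and the same acceptance rule) sampling $\mu_0$. Then $$e^{-3\operatorname{osc}V_1}\,\mathrm{Gap}(\mathcal{T}_0)\le \mathrm{Gap}(\mathcal{T}_\epsilon)\le e^{3\operatorname{osc}V_1}\,\mathrm{Gap}(\mathcal{T}_0).$$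
   Context: Potentials. $V_0:\mathbb{R}^n\to\mathbb{R}$ is smooth, bounded below, trapping ($V_0(x)\to\infty$ as $|x|\to\infty$), with $e^{-V_0}$ integrable; $V_1(x,y)$ is smooth and bounded. The inverse temperature is $\beta=1$. Put $\mu(dx)=Z^{-1}e^{-V_\epsilon(x)}dx$ and $\mu_0(dx)=Z_0^{-1}e^{-V_0(x)}dx$, with $Z,Z_0$ the normalizing constants ($\mu$ depends on $\epsilon$). Sampler. For a target density proportional to $e^{-V}$ and a proposal kernel with (positive) density $q(x\to y)$, set $R(x,y)=V(x)-V(y)+\log\frac{q(y\to x)}{q(x\to y)}$. Given $X_k$, a proposal $X^{\mathrm p}_{k+1}\sim q(X_k\to\cdot)$ is drawn; with probability $F(R(X_k,X^{\mathrm p}_{k+1}))$ one sets $X_{k+1}=X^{\mathrm p}_{k+1}$, otherwise $X_{k+1}=X_k$. Here $F$ is either the Metropolis rule $F(r)=\min(1,e^{r})$ or the Barker rule $F(r)=(1+e^{-r})^{-1}$. Spectral gap. For a chain reversible with respect to a probability measure $\pi$ with transition operator $\mathcal{T}$ on $L^2(\pi)$, $\mathrm{Gap}(\mathcal{T})=1-\sup_{\lambda\in\sigma(\mathcal{T})\setminus\{1\}}\lambda$, used in its Dirichlet-form (variational) expression $$\mathrm{Gap}(\mathcal{T})=\inf_{f\in L^2(\pi),\ \mathrm{Var}_\pi(f)>0}\frac{\mathbb{E}_\pi[|f(X_{k+1})-f(X_k)|^2]}{2\,\mathrm{Var}_\pi(f(X))},$$ where $\mathbb{E}_\pi$ is taken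 over one step of the chain started from $X_k\sim\pi$. *)

(* Defs.v *)
From HB Require Import structures.
From mathcomp Require Import all_boot all_order all_algebra.
From mathcomp Require Import interval_inference.
From mathcomp Require Import all_classical all_reals all_analysis.
From mathcomp Require Import measurable_realfun.

Set Implicit Arguments.
Unset Strict Implicit.
Unset Printing Implicit Defensive.
Import Order.TTheory GRing.Theory Num.Theory.
Import numFieldNormedType.Exports.
Local Open Scope classical_set_scope.
Local Open Scope ring_scope.

(* The sigma-algebra on row vectors generated by the coordinate maps. Over the
   reals it is the Borel sigma-algebra: see [open_measurable_rV]. *)
Definition measure_rV_display : measure_display -> measure_display.
Proof. exact. Qed.

Section measurable_rV.
Context {d : measure_display} {T : measurableType d}.
Variable n : nat.

Let coors : 'I_n -> 'rV[T]_n -> T := fun i x => x ord0 i.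

Let rV_set0 : g_sigma_preimage coors set0.
Proof. exact: sigma_algebra0. Qed.

Let rV_setC A : g_sigma_preimage coors A -> g_sigma_preimage coors (~` A).
Proof. exact: sigma_algebraC. Qed.

Let rV_bigcup (F : _^nat) : (forall i, g_sigma_preimage coors (F i)) ->
  g_sigma_preimage coors (\bigcup_i (F i)).
Proof. exact: sigma_algebra_bigcup. Qed.

HB.instance Definition _ := @isMeasurable.Build (measure_rV_display d)
  'rV[T]_n (g_sigma_preimage coors) rV_set0 rV_setC rV_bigcup.

Lemma measurable_coord_rV (i : 'I_n) :
  measurable_fun [set: 'rV[T]_n] (fun x : 'rV[T]_n => x ord0 i).
Proof.
move=> _ Y mY; rewrite setTI; apply: sub_sigma_algebra => /=.
rewrite -bigcup_seq/=; exists i => /=; first by rewrite mem_index_enum.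
by exists Y => //; rewrite setTI.
Qed.

Lemma measurable_fun_rVP d' (S : measurableType d') (f : S -> 'rV[T]_n) :
  measurable_fun [set: S] f <->
  forall i, measurable_fun [set: S] (fun x => f x ord0 i).
Proof.
split=> [mf i|mf].
  by apply: (measurableT_comp (measurable_coord_rV i) mf).
have : g_sigma_preimage (fun i => coors i \o f) `<=` measurable.
  apply: smallest_sub; first exact: sigma_algebra_measurable.
  rewrite -bigcup_seq; apply: bigcup_sub => i _ A [B mB <-].
  exact: mf.
by rewrite g_sigma_preimage_comp => sub _ A mA; apply: sub; exists A.
Qed.

End measurable_rV.

Section rV_borel.
Context {R : realType} {n : nat}.
Local Notation E := 'rV[R]_n.

Let measurable_ball_rV (x : E) (e : R) : measurable (ball x e : set E).
Proof.
have [e0|e0] := ltP 0 e; last first.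
  rewrite (_ : ball x e = set0) //; apply/seteqP; split => // y.
  by case=> /lt_le_trans /(_ e0); rewrite ltxx.
rewrite (_ : ball x e =
    \big[setI/setT]_(i < n) ((fun y : E => y ord0 i) @^-1` ball (x ord0 i) e)).
  apply: bigsetI_measurable => i _; rewrite -[X in measurable X]setTI.
  apply: measurable_coord_rV => //.
  by apply: open_measurable; exact: ball_open.
rewrite -bigcap_seq; apply/seteqP; split => [y [_ xy] i _|y xy].
  exact: xy.
split=> // i j; rewrite (ord1 i); apply: (xy j).
by rewrite /= mem_index_enum.
Qed.

Lemma open_measurable_rV (U : set E) : open U -> measurable U.
Proof.
move=> oU.
pose B (k : 'rV[rat]_n * rat) : set E :=
  ball (\row_i ratr (k.1 ord0 i) : E) (ratr k.2).
pose F (m : nat) : set E :=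
  if unpickle m is Some k then
    if `[< B k `<=` U >] then B k else set0
  else set0.
rewrite (_ : U = \bigcup_m F m); last first.
  apply/seteqP; split => [x Ux|x [m _]]; last first.
    rewrite /F; case: unpickle => // k; case: asboolP => // BU; exact: BU.
  have /nbhs_ballP[e /= e0 eU] : nbhs x U by exact: open_nbhs_nbhs.
  have e20 : 0 < e / 2 by rewrite divr_gt0.
  have [q /andP[]] : exists q : rat, (0 < ratr q :> R) && (ratr q < e / 2).
    have [q] := rat_in_itvoo e20.
    by rewrite in_itv /=; exists q.
  move=> q0 qe.
  have /choice[c hc] : forall i : 'I_n, exists r : rat,
      `|x ord0 i - ratr r| < ratr q.
    move=> i.
    have [r] := rat_in_itvoo (ltr_pwDr q0 (lexx (x ord0 i))).
    rewrite in_itv /= => /andP[r1 r2]; exists r.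
    by rewrite ltr_distlC r2 andbT (lt_trans _ r1)// ltrBlDr ltrDl.
  pose k : 'rV[rat]_n * rat := (\row_i c i, q).
  have Bx : B k x.
    split => // i j; rewrite /ball /= !mxE distrC (ord1 i).
    exact: hc.
  exists (pickle k) => //; rewrite /F pickleK.
  case: asboolP => // -[] y By; apply: eU.
  have qqe : ratr q + ratr q <= e by rewrite [leRHS]splitr lerD// ltW.
  exact: le_ball qqe _ (ball_triangle (ball_sym Bx) By).
apply: bigcup_measurable => m _; rewrite /F.
case: unpickle => [k|//]; case: asboolP => // _; exact: measurable_ball_rV.
Qed.

Lemma continuous_measurable_rV (f : E -> R) :
  continuous f -> measurable_fun [set: E] f.
Proof.
move=> /continuousP cf; apply: (measurability _ (RGenOpens.measurableE R)).
move=> _ [_ [a [b ->] <-]]; rewrite setTI.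
by apply: open_measurable_rV; apply: cf; exact: interval_open.
Qed.

End rV_borel.

Section lebesgue_rV.
Variable R : realType.

Definition cons_rV n (p : R * 'rV[R]_n) : 'rV[R]_n.+1 :=
  row_mx (const_mx p.1 : 'rV_1) p.2.

Definition uncons_rV n (x : 'rV[R]_n.+1) : R * 'rV[R]_n :=
  (x ord0 ord0, rsubmx (x : 'rV_(1 + n))).

Lemma cons_rVK n : cancel (@cons_rV n) (@uncons_rV n).
Proof.
case=> a v; rewrite /uncons_rV /cons_rV /= row_mxKr; congr (_, _).
transitivity (row_mx (const_mx a : 'rV_1) v ord0 (lshift n ord0)).
  by congr (row_mx _ _ _ _); exact: val_inj.
by rewrite row_mxEl mxE.
Qed.

Lemma measurable_cons_rV n :
  measurable_fun [set: R * 'rV[R]_n] (@cons_rV n).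
Proof.
apply/measurable_fun_rVP => i; rewrite /cons_rV.
under eq_fun do rewrite mxE.
case: (fintype.split (i : 'I_(1 + n))) => j.
  under eq_fun do rewrite mxE.
  exact: measurable_fst.
exact: (measurableT_comp (measurable_coord_rV j) measurable_snd).
Qed.

Lemma measurable_uncons_rV n :
  measurable_fun [set: 'rV[R]_n.+1] (@uncons_rV n).
Proof.
apply/measurable_fun_pairP; split; first exact: measurable_coord_rV.
apply/measurable_fun_rVP => i /=.
rewrite (_ : (fun x => _) = fun x : 'rV[R]_n.+1 => x ord0 (rshift 1 i)).
  exact: measurable_coord_rV.
by apply/funext => x /=; rewrite mxE.
Qed.

HB.instance Definition _ n := isMeasurableFun.Build _ _ _ _ (@cons_rV n)
  (@measurable_cons_rV n).

Definition lebesgue_rVS n (mu : {sigma_finite_measure set 'rV[R]_n -> \bar R})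
    : set 'rV[R]_n.+1 -> \bar R :=
  pushforward (lebesgue_measure \x mu)%E (@cons_rV n).

Section lebesgue_rVS.
Context n (mu : {sigma_finite_measure set 'rV[R]_n -> \bar R}).

Let lebesgue_rVS0 : lebesgue_rVS mu set0 = 0%E.
Proof. by have mf := @measurable_cons_rV n; exact: measure0. Qed.

Let lebesgue_rVS_ge0 A : (0 <= lebesgue_rVS mu A)%E.
Proof. by have mf := @measurable_cons_rV n; exact: measure_ge0. Qed.

Let lebesgue_rVS_sigma_additive : semi_sigma_additive (lebesgue_rVS mu).
Proof.
have mf := @measurable_cons_rV n; exact: measure_semi_sigma_additive.
Qed.

HB.instance Definition _ := isMeasure.Build _ _ _ (lebesgue_rVS mu)
  lebesgue_rVS0 lebesgue_rVS_ge0 lebesgue_rVS_sigma_additive.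

Let lebesgue_rVS_sigma_finite : sigma_finite setT (lebesgue_rVS mu).
Proof.
have /sigma_finiteP[F [FT ndF mF]] := sigma_finiteT (@lebesgue_measure R).
have /sigma_finiteP[G [GT ndG mG]] := sigma_finiteT mu.
exists (fun k => @uncons_rV n @^-1` (F k `*` G k)).
  rewrite -preimage_bigcup (_ : \bigcup_k _ = setT) ?preimage_setT//.
  apply/seteqP; split=> // -[a v] _.
  have [i _ Fi] : (\bigcup_k F k) a by rewrite -FT.
  have [j _ Gj] : (\bigcup_k G k) v by rewrite -GT.
  exists (maxn i j) => //; split => /=.
  - by move: a Fi; exact/subsetPset/ndF/leq_maxl.
  - by move: v Gj; exact/subsetPset/ndG/leq_maxr.
move=> k; have [mFk Fk] := mF k; have [mGk Gk] := mG k; split.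
  rewrite -[X in measurable X]setTI; apply: measurable_uncons_rV => //.
  exact: measurableX.
rewrite /lebesgue_rVS /pushforward -comp_preimage.
rewrite (_ : _ \o _ = id); last by apply/funext => p; exact: cons_rVK.
rewrite preimage_id product_measure1E//.
by rewrite lte_mul_pinfty// ge0_fin_numE.
Qed.

HB.instance Definition _ := Measure_isSigmaFinite.Build _ _ _ (lebesgue_rVS mu)
  lebesgue_rVS_sigma_finite.

End lebesgue_rVS.

(* Lebesgue measure on R^n, as the n-fold product of [lebesgue_measure]. *)
Fixpoint lebesgue_rV n : {sigma_finite_measure set 'rV[R]_n -> \bar R} :=
  match n with
  | 0 => \d_(0 : 'rV[R]_0)
  | m.+1 => lebesgue_rVS (lebesgue_rV m)
  end.

Lemma lebesgue_rV_box n (A : 'I_n -> set R) : (forall i, measurable (A i)) ->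
  lebesgue_rV n [set x | forall i, A i (x ord0 i)] =
  (\prod_(i < n) lebesgue_measure (A i))%E.
Proof.
elim: n A => [|n IHn] A mA.
  by rewrite big_ord0 /= diracE mem_set//= => -[].
pose B := [set v : 'rV[R]_n | forall i, A (lift ord0 i) (v ord0 i)].
have mB : measurable B.
  rewrite (_ : B = \bigcap_(i in [set: 'I_n])
      ((fun v : 'rV[R]_n => v ord0 i) @^-1` A (lift ord0 i))); last first.
    by apply/seteqP; split => [v Bv i _|v Bv i]; exact: Bv.
  apply: fin_bigcap_measurable => // i _; rewrite -[X in measurable X]setTI.
  exact: measurable_coord_rV.
rewrite big_ord_recl -IHn//= /lebesgue_rVS /pushforward -product_measure1E//; last exact: mA.
congr (product_measure1 _ _ _); apply/seteqP.
have consE0 (p : R * 'rV[R]_n) : cons_rV p ord0 ord0 = p.1.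
  by rewrite -[in RHS](cons_rVK p).
have consEl (p : R * 'rV[R]_n) i : cons_rV p ord0 (lift ord0 i) = p.2 ord0 i.
  transitivity (row_mx (const_mx p.1 : 'rV_1) p.2 ord0 (rshift 1 i)).
    by congr (row_mx _ _ _ _); exact: val_inj.
  exact: row_mxEr.
split=> [p Ap|p [Ap0 ApB] i].
  split; first by rewrite -consE0; exact: Ap.
  by move=> i; rewrite -consEl; exact: Ap.
have [j ->|->] := fintype.unliftP ord0 i; first by rewrite consEl; exact: ApB.
by rewrite consE0.
Qed.

End lebesgue_rV.
Arguments lebesgue_rV {R} n.

Section smooth.
Context {R : realType} {U : normedModType R}.

(* [iter_derive f [:: v1; ...; vk]] is the iterated directional derivative
   ['D_v1 (... ('D_vk f))], and [smooth] is C^oo. *)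
Fixpoint iter_derive (f : U -> R) (vs : seq U) : U -> R :=
  if vs is v :: vs' then 'D_v (iter_derive f vs') else f.

Definition smooth (f : U -> R) : Prop :=
  forall vs x, differentiable (iter_derive f vs : U -> R^o) x.

Record smoothFun := SmoothFun {
  smooth_fun :> U -> R;
  smooth_funP : smooth smooth_fun }.

Lemma smooth_continuous (f : smoothFun) : continuous f.
Proof.
by move=> x; exact: (differentiable_continuous (smooth_funP f [::] x)).
Qed.

End smooth.
Arguments smoothFun {R} U.

Section potential.
Context {R : realType} {n : nat}.
Local Notation E := 'rV[R]_n.

HB.instance Definition _ (V : smoothFun E) :=
  isMeasurableFun.Build _ _ _ _ (smooth_fun V)
    (continuous_measurable_rV (@smooth_continuous _ _ V)).

(* [eps^-1 *: x] stands for the fast variable [x / eps]. *)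
Definition multiscale (V0 : smoothFun E) (V1 : smoothFun (E * E)%type)
  (eps : R) : E -> R := fun x => V0 x + V1 (x, eps^-1 *: x).

Section multiscale.
Variables (V0 : smoothFun E) (V1 : smoothFun (E * E)%type) (eps : R).

Let measurable_multiscale : measurable_fun [set: E] (multiscale V0 V1 eps).
Proof.
apply: continuous_measurable_rV => x.
apply: (@continuousD _ _ _ V0 (fun x : E => V1 (x, eps^-1 *: x))).
  exact: smooth_continuous.
apply: (@continuous2_cvg _ E E R (nbhs x) _ id _ (fun y z => V1 (y, z))).
- rewrite (_ : (fun z => _) = V1 :> (E * E -> R)); last by apply/funext => -[].
  exact: smooth_continuous.
- exact: cvg_id.
- exact: scaler_continuous.
Qed.

HB.instance Definition _ :=
  isMeasurableFun.Build _ _ _ _ (multiscale V0 V1 eps) measurable_multiscale.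

End multiscale.

Definition osc (V1 : E * E -> R) (eps : R) : R :=
  sup (range (fun x : E => V1 (x, eps^-1 *: x)))
  - inf (range (fun x : E => V1 (x, eps^-1 *: x))).

(* [`|x|] is the maximum norm of [x]. *)
Definition trapping (V : E -> R) : Prop :=
  forall M, exists r, forall x, r < `|x| -> M < V x.

End potential.

Section gibbs.
Context {R : realType} {n : nat}.
Local Notation E := 'rV[R]_n.
Local Open Scope ereal_scope.

Definition boltzmann (V : E -> R) (A : set E) : \bar R :=
  \int[lebesgue_rV n]_(x in A) (expR (- V x))%:E.

Section boltzmann.
Variable V : {mfun E >-> R}.

Let boltzmann0 : boltzmann V set0 = 0.
Proof. exact: integral_set0. Qed.

Let boltzmann_ge0 A : 0 <= boltzmann V A.
Proof. by apply: integral_ge0 => x _; rewrite lee_fin expR_ge0. Qed.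

Let boltzmann_sigma_additive : semi_sigma_additive (boltzmann V).
Proof.
apply: semi_sigma_additive_nng_induced => [|x]; last by rewrite lee_fin expR_ge0.
apply/measurable_EFinP; apply: measurableT_comp => //.
exact: measurableT_comp.
Qed.

HB.instance Definition _ := isMeasure.Build _ _ _ (boltzmann V)
  boltzmann0 boltzmann_ge0 boltzmann_sigma_additive.

End boltzmann.

(* [Z^-1 exp(- V x) dx]. The second argument of [mnormalize] is the junk value
   returned when [Z = +oo]. *)
Definition gibbs (V : {mfun E >-> R}) : probability E R :=
  mnormalize (boltzmann V) \d_(0%R : E).

End gibbs.

Variant acceptance := Metropolis | Barker.

Definition acceptance_fun {R : realType} (a : acceptance) (r : R) : R :=
  match a with
  | Metropolis => Num.min 1 (expR r)
  | Barker => (1 + expR (- r))^-1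
  end.

Lemma acceptance_fun_ge0 {R : realType} a (r : R) : 0 <= acceptance_fun a r.
Proof.
case: a => /=; first by rewrite le_min ler01 expR_ge0.
by rewrite invr_ge0 addr_ge0// expR_ge0.
Qed.

Lemma acceptance_fun_le1 {R : realType} a (r : R) : acceptance_fun a r <= 1.
Proof.
case: a => /=; first by rewrite ge_min lexx.
by rewrite invf_le1 ?lerDl ?expR_ge0// ltr_pwDl// expR_ge0.
Qed.

Lemma measurable_acceptance_fun {R : realType} a :
  measurable_fun [set: R] (acceptance_fun a).
Proof.
case: a => /=; first exact: measurable_minr.
apply: measurable_funTS; apply: continuous_measurable_fun => x.
apply: cvgV; first by rewrite gt_eqF// ltr_pwDl// expR_ge0.
apply: cvgD; first exact: cvg_cst.
by apply: continuous_comp; [exact: opp_continuous|exact: continuous_expR].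
Qed.

Record proposal (R : realType) (n : nat) := Proposal {
  proposal_density :> 'rV[R]_n -> 'rV[R]_n -> R;
  proposal_gt0 : forall x y, 0 < proposal_density x y;
  measurable_proposal :
    measurable_fun [set: 'rV[R]_n * 'rV[R]_n] (fun z => proposal_density z.1 z.2);
  proposal_int1 : forall x,
    (\int[lebesgue_rV n]_y (proposal_density x y)%:E = 1)%E }.

Section proposal_kernel.
Context {R : realType} {n : nat}.
Local Notation E := 'rV[R]_n.
Variable q : proposal R n.
Local Open Scope ereal_scope.

Definition proposal_measure (x : E) (A : set E) : \bar R :=
  \int[lebesgue_rV n]_(y in A) (q x y)%:E.

Let measurable_q2 x : measurable_fun [set: E] (q x).
Proof.
exact: (measurableT_comp (measurable_proposal q) (pair1_measurable x)).
Qed.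

Let proposal_measure0 x : proposal_measure x set0 = 0.
Proof. exact: integral_set0. Qed.

Let proposal_measure_ge0 x A : 0 <= proposal_measure x A.
Proof. by apply: integral_ge0 => y _; rewrite lee_fin ltW// proposal_gt0. Qed.

Let proposal_measure_sigma_additive x :
  semi_sigma_additive (proposal_measure x).
Proof.
apply: semi_sigma_additive_nng_induced => [|y].
  by apply/measurable_EFinP; exact: measurable_q2.
by rewrite lee_fin ltW// proposal_gt0.
Qed.

HB.instance Definition _ x := isMeasure.Build _ _ _ (proposal_measure x)
  (proposal_measure0 x) (proposal_measure_ge0 x)
  (@proposal_measure_sigma_additive x).

Definition kproposal (x : E) : {measure set E -> \bar R} := proposal_measure x.

Let measurable_kproposal A : measurable A ->
  measurable_fun [set: E] (kproposal ^~ A).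
Proof.
move=> mA.
rewrite (_ : _ ^~ _ =
    fun x => \int[lebesgue_rV n]_y (q x y * \1_A y)%:E); last first.
  apply/funext => x; rewrite /kproposal /= /proposal_measure.
  rewrite integral_mkcond; apply: eq_integral => y _.
  by rewrite patchE indicE; case: ifPn => _; rewrite ?mulr1 ?mulr0.
apply: (@measurable_fun_fubini_tonelli_F _ _ E E R (lebesgue_rV n)
  (fun z => (q z.1 z.2 * \1_A z.2)%:E)).
  apply/measurable_EFinP; apply: measurable_funM.
    exact: measurable_proposal.
  exact: (measurableT_comp (measurable_indic mA) measurable_snd).
by move=> z /=; rewrite lee_fin mulr_ge0// ltW// proposal_gt0.
Qed.

HB.instance Definition _ := isKernel.Build _ _ E E R kproposal
  measurable_kproposal.

Let kproposal_prob x : kproposal x [set: E] = 1.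
Proof. exact: proposal_int1. Qed.

HB.instance Definition _ := Kernel_isProbability.Build _ _ E E R kproposal
  kproposal_prob.

End proposal_kernel.

Section sampler.
Context {R : realType} {n : nat}.
Local Notation E := 'rV[R]_n.

Definition log_ratio (V : E -> R) (q : E -> E -> R) (x y : E) : R :=
  V x - V y + ln (q y x / q x y).

Definition accept_prob (a : acceptance) (V : E -> R) (q : E -> E -> R)
  (x y : E) : R := acceptance_fun a (log_ratio V q x y).

Let accept_prob_ge0 a V q x y : 0 <= accept_prob a V q x y.
Proof. exact: acceptance_fun_ge0. Qed.

Let reject_prob_ge0 a V q x y : 0 <= 1 - accept_prob a V q x y.
Proof. by rewrite subr_ge0; exact: acceptance_fun_le1. Qed.

(* The law of the next state given [z = (current state, proposed state)]. *)
Definition kaccept a (V : E -> R) (q : E -> E -> R) (z : E * E) :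
    {measure set E -> \bar R} :=
  measure_add (mscale (NngNum (accept_prob_ge0 a V q z.1 z.2)) \d_(z.2))
              (mscale (NngNum (reject_prob_ge0 a V q z.1 z.2)) \d_(z.1)).

Lemma kacceptE a (V : E -> R) (q : E -> E -> R) (z : E * E) (A : set E) :
  kaccept a V q z A = (accept_prob a V q z.1 z.2 * \1_A z.2
                       + (1 - accept_prob a V q z.1 z.2) * \1_A z.1)%:E.
Proof. exact: measure_addE. Qed.

Variables (a : acceptance) (V : {mfun E >-> R}) (q : proposal R n).

Let measurable_accept_prob :
  measurable_fun [set: E * E] (fun z => accept_prob a V q z.1 z.2).
Proof.
apply: (measurableT_comp (measurable_acceptance_fun a)).
have mq := measurable_proposal q.
have mq' : measurable_fun [set: E * E] (fun z => q z.2 z.1).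
  exact: (measurableT_comp mq
    (measurable_fun_pair measurable_snd measurable_fst)).
apply: measurable_funD.
  by apply: measurable_funB; apply: measurableT_comp.
under eq_fun do rewrite ln_div ?posrE ?proposal_gt0//.
by apply: measurable_funB; apply: (measurableT_comp (@measurable_ln R)).
Qed.

Let measurable_kaccept A : measurable A ->
  measurable_fun [set: E * E] (kaccept a V q ^~ A).
Proof.
move=> mA; rewrite (_ : (fun z => kaccept a V q z A) = fun z =>
    (accept_prob a V q z.1 z.2 * \1_A z.2
     + (1 - accept_prob a V q z.1 z.2) * \1_A z.1)%:E); last first.
  by apply/funext => z; rewrite kacceptE.
apply/measurable_EFinP; apply: measurable_funD; apply: measurable_funM => //.
- exact: (measurableT_comp (measurable_indic mA) measurable_snd).
- exact: measurable_funB.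
- exact: (measurableT_comp (measurable_indic mA) measurable_fst).
Qed.

HB.instance Definition _ := isKernel.Build _ _ (E * E)%type E R (kaccept a V q)
  measurable_kaccept.

Let kaccept_prob z : kaccept a V q z [set: E] = 1%E.
Proof.
by rewrite kacceptE !indicT !mulr1 addrC subrK.
Qed.

HB.instance Definition _ := Kernel_isProbability.Build _ _ (E * E)%type E R
  (kaccept a V q) kaccept_prob.

(* One step of the chain: draw a proposal from [q], then accept or reject. *)
Definition transition (x : E) : {measure set E -> \bar R} :=
  (kproposal q \; kaccept a V q)%E x.

Let measurable_transition A : measurable A ->
  measurable_fun [set: E] (transition ^~ A).
Proof. exact: measurable_kernel. Qed.

HB.instance Definition _ := isKernel.Build _ _ E E R transition
  measurable_transition.

Let transition_prob x : transition x [set: E] = 1%E.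
Proof.
transitivity (\int[kproposal q x]_y cst 1 y)%E.
  by apply: eq_integral => y _; exact: (@prob_kernel _ _ _ _ _ (kaccept a V q)).
by rewrite integral_cst//= mul1e (@prob_kernel _ _ _ _ _ (kproposal q)).
Qed.

HB.instance Definition _ := Kernel_isProbability.Build _ _ E E R transition
  transition_prob.

End sampler.

(* Variational form of the spectral gap of the transition operator
   [f |-> (x |-> \int[P x]_y f y)] on [L^2(pi)]. *)
Definition spectral_gap d (T : measurableType d) (R : realType)
    (pi : probability T R) (P : R.-pker T ~> T) : \bar R :=
  ereal_inf [set ((\int[pi]_x \int[P x]_y (`|f y - f x| ^+ 2)%:E)
                  / (2%:E * 'V_pi[f]))%E
            | f in [set f : T -> R | f \in Lfun pi 2%:E /\ (0 < 'V_pi[f])%E]].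

(* Main.v *)
(* With s = e^{-V(x)} q(x,y) and t = e^{-V(y)} q(y,x), the probability flux
   e^{-V(x)} q(x,y) F(R(x,y)) is min(s,t) for Metropolis and (1/s + 1/t)^-1 for
   Barker, hence nondecreasing and homogeneous of degree one in (s,t). If
   m <= V - U <= M, the unnormalized Dirichlet form of V is therefore at most
   e^{-m} times that of U, and the normalized one at most e^{M-m} times that of
   U. The density of the Gibbs measures compares in the same way, and since the
   variance minimizes the mean square distance to constants, so do variances.
   This gives Gap(V) <= e^{2(M-m)} Gap(U), better than the exponent 3 needed,
   and exchanging the roles of U and V gives the other bound. *)
Require Import Defs.
From mathcomp Require Import all_boot all_order all_algebra.
From mathcomp Require Import all_classical all_reals all_analysis.
From mathcomp Require Import measurable_realfun ring lra.
Import Order.TTheory GRing.Theory Num.Theory.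
Import numFieldNormedType.Exports.
Local Open Scope classical_set_scope.
Local Open Scope ring_scope.

(** * Integration against a measure given by a density *)

Section density.
Local Open Scope ereal_scope.
Import HBNNSimple.

(** By [nuE] the identity holds for indicators, by linearity for simple functions, and in the limit
    by monotone convergence on both sides. It is applied to the proposal kernel and to the Gibbs
    measure. *)
Lemma ge0_integral_density {d} {T : measurableType d} {R : realType}
    {mu nu : {measure set T -> \bar R}} {g : T -> R}
    (g0 : forall x, (0 <= g x)%R) (mg : measurable_fun [set: T] g)
    (nuE : forall A, measurable A -> nu A = \int[mu]_(x in A) (g x)%:E)
    {f : T -> \bar R} (f0 : forall x, 0 <= f x)
    (mf : measurable_fun [set: T] f) :
  \int[nu]_x f x = \int[mu]_x (f x * (g x)%:E).
Proof.
have mgE : measurable_fun [set: T] (EFin \o g) by exact/measurable_EFinP.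
have nnsfunE (h : {nnsfun T >-> R}) :
    \int[nu]_x (h x)%:E = \int[mu]_x ((h x)%:E * (g x)%:E).
  rewrite integralT_nnsfun sintegralE.
  transitivity (\int[mu]_x (\sum_(r \in range h)
      (r * \1_(h @^-1` [set r]) x)%:E * (g x)%:E)); last first.
    apply: eq_integral => x _; rewrite -ge0_mule_fsuml => [|r]; last first.
      exact: nnfun_muleindic_ge0.
    by rewrite fsumEFin // -(fimfunE _ x).
  rewrite ge0_integral_fsum//; last 2 first.
    - move=> r; apply: emeasurable_funM => //.
      by apply/measurable_EFinP; exact: measurable_funM.
    - by move=> r x _; rewrite mule_ge0 ?lee_fin//; exact: nnfun_muleindic_ge0.
  (* Writing [r] as a value of [h] supplies the sign needed to move it across the integral. *)
  apply: eq_fsbigr => r /[!inE] -[t _ <-].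
  rewrite nuE//.
  rewrite integral_mkcond -ge0_integralZl//; last 3 first.
    - by apply/(measurable_restrictT _ _).1 => //; exact: measurable_funTS.
    - by move=> x _; apply: erestrict_ge0 => y _; rewrite lee_fin.
    - by rewrite lee_fin.
  apply: eq_integral => x _; rewrite patchE indicE.
  by case: ifPn => _; rewrite ?mulr1 ?mulr0 ?mule0 ?mul0e.
pose h := nnsfun_approx measurableT mf.
have hf x : f x = limn (fun n => (h n x)%:E).
  by apply/esym/cvg_lim => //; exact: cvg_nnsfun_approx.
have hfg x : f x * (g x)%:E = limn (fun n => (h n x)%:E * (g x)%:E).
  apply/esym/cvg_lim => //; apply: cvgeZr => //.
  exact: cvg_nnsfun_approx.
under eq_integral do rewrite hf.
under [RHS]eq_integral do rewrite hfg.
rewrite !monotone_convergence//.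
- by under eq_fun do rewrite nnsfunE.
- by move=> n; apply: emeasurable_funM => //; exact/measurable_EFinP.
- by move=> n x _; rewrite mule_ge0// lee_fin.
- move=> x _ a b ab; rewrite lee_wpmul2r ?lee_fin//.
  exact/lefP/nd_nnsfun_approx.
- by move=> n; exact/measurable_EFinP.
- by move=> n x _; rewrite lee_fin.
- by move=> x _ a b ab; rewrite lee_fin; exact/lefP/nd_nnsfun_approx.
Qed.

End density.

(** * The probability flux of accepted moves *)

Definition flux {R : realType} (a : acceptance) (s t : R) : R :=
  match a with
  | Metropolis => Num.min s t
  | Barker => (s^-1 + t^-1)^-1
  end.

(** Here [s] and [t] are the weights of a move and of its reverse. Absorbing [s] into [min(1, t/s)]
    or [1/(1 + s/t)] leaves an expression symmetric in both. *)
Lemma acceptance_fun_flux {R : realType} (a : acceptance) (s t : R)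
    (s0 : 0 < s) (t0 : 0 < t) :
  s * acceptance_fun a (ln (t / s)) = flux a s t.
Proof.
have ts0 : t / s \is Num.pos by rewrite posrE divr_gt0.
case: a => /=.
  by rewrite lnK// minr_pMr ?(ltW s0)// mulr1 mulrCA divff ?mulr1// gt_eqF.
rewrite expRN lnK// invf_div.
by field; rewrite !gt_eqF ?addr_gt0.
Qed.

Lemma le_flux {R : realType} (a : acceptance) {c s t s' t' : R} (c0 : 0 < c)
    (s'0 : 0 < s') (t'0 : 0 < t') (s's : s' <= c * s) (t't : t' <= c * t) :
  flux a s' t' <= c * flux a s t.
Proof.
have s0 : 0 < s by rewrite -(pmulr_rgt0 _ c0) (lt_le_trans s'0).
have t0 : 0 < t by rewrite -(pmulr_rgt0 _ c0) (lt_le_trans t'0).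
case: a => /=.
  by rewrite minr_pMr ?(ltW c0)// le_min !ge_min s's t't orbT.
(* After inversion the Barker case reads [1/(c s) + 1/(c t) <= 1/s' + 1/t'], which holds term by
   term. *)
rewrite -[leRHS]invrK invfM invrK lef_pV2 ?posrE; last 2 first.
- by rewrite addr_gt0 ?invr_gt0.
- by rewrite mulr_gt0 ?addr_gt0 ?invr_gt0.
rewrite mulrDr -!invfM.
by rewrite lerD// lef_pV2 ?posrE// mulr_gt0.
Qed.

Section sampler_flux.
Context {R : realType} {n : nat}.
Local Notation E := 'rV[R]_n.

Lemma accept_prob_flux a (V : E -> R) (q : proposal R n) (x y : E) :
  expR (- V x) * q x y * accept_prob a V q x y =
  flux a (expR (- V x) * q x y) (expR (- V y) * q y x).
Proof.
have qxy := proposal_gt0 q x y; have qyx := proposal_gt0 q y x.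
rewrite -acceptance_fun_flux ?mulr_gt0 ?expR_gt0// /accept_prob /log_ratio.
congr (_ * acceptance_fun a _).
rewrite !(ln_div, lnM) ?posrE ?mulr_gt0 ?expR_gt0// !expRK.
by ring.
Qed.

(** Since [U] and [V] share the same [q], both weights of the flux for [V] are at most [exp(-m)]
    times those for [U]. *)
Lemma le_accept_prob a {U V : E -> R} {m : R} (q : proposal R n)
    (mUV : forall x, m <= V x - U x) (x y : E) :
  expR (- V x) * q x y * accept_prob a V q x y <=
  expR (- m) * (expR (- U x) * q x y * accept_prob a U q x y).
Proof.
have leV z : expR (- V z) <= expR (- m) * expR (- U z).
  by rewrite -expRD ler_expR; have := mUV z; lra.
have qxy := proposal_gt0 q x y; have qyx := proposal_gt0 q y x.
rewrite !accept_prob_flux; apply: le_flux; rewrite ?mulr_gt0 ?expR_gt0//.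
- by rewrite mulrA ler_wpM2r ?leV// ltW.
- by rewrite mulrA ler_wpM2r ?leV// ltW.
Qed.

End sampler_flux.

(** * One-step integrals of the sampler *)

Section sampler_integrals.
Context {R : realType} {n : nat}.
Local Notation E := 'rV[R]_n.
Local Open Scope ereal_scope.
Variables (a : acceptance) (q : proposal R n).

Lemma measurable_proposalr x : measurable_fun [set: E] (q x).
Proof.
exact: (measurableT_comp (measurable_proposal q) (pair1_measurable x)).
Qed.

Lemma measurable_accept_prob (V : {mfun E >-> R}) :
  measurable_fun [set: E * E] (fun z => accept_prob a V q z.1 z.2).
Proof.
apply: (measurableT_comp (measurable_acceptance_fun a)).
have mq := measurable_proposal q.
have mq' : measurable_fun [set: E * E] (fun z => q z.2 z.1).
  exact: (measurableT_comp mq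
    (measurable_fun_pair measurable_snd measurable_fst)).
apply: measurable_funD.
  by apply: measurable_funB; apply: measurableT_comp.
under eq_fun do rewrite ln_div ?posrE ?proposal_gt0//.
by apply: measurable_funB; apply: (measurableT_comp (@measurable_ln R)).
Qed.

Lemma measurable_sqr_increment {f : E -> R} (mf : measurable_fun [set: E] f) :
  measurable_fun [set: E * E] (fun z => (`|f z.2 - f z.1| ^+ 2)%R).
Proof.
apply: measurable_funX; apply: measurableT_comp => //.
by apply: measurable_funB; apply: measurableT_comp.
Qed.

(** A rejected proposal leaves the chain at [x], where the increment vanishes, so only the accepted
    part of the kernel contributes. *)
Lemma integral_transition_sqr_increment (V : {mfun E >-> R}) {f : E -> R}
    (mf : measurable_fun [set: E] f) (x : E) :
  \int[transition a V q x]_y (`|f y - f x| ^+ 2)%:E =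
  \int[lebesgue_rV n]_y
    (accept_prob a V q x y * `|f y - f x| ^+ 2 * q x y)%:E.
Proof.
have mfx : measurable_fun [set: E] (fun y => (`|f y - f x| ^+ 2)%:E).
  apply/measurable_EFinP.
  exact: (measurableT_comp (measurable_sqr_increment mf) (pair1_measurable x)).
have sq0 y : 0 <= (`|f y - f x| ^+ 2)%:E by rewrite lee_fin sqr_ge0.
have acc0 y : 0 <= (accept_prob a V q x y)%:E.
  by rewrite lee_fin; exact: acceptance_fun_ge0.
rewrite /transition integral_kcomp//.
transitivity (\int[proposal_measure q x]_y
    ((accept_prob a V q x y)%:E * (`|f y - f x| ^+ 2)%:E)).
  apply: eq_integral => y _; rewrite /= /kaccept.
  rewrite ge0_integral_measure_add// !ge0_integral_mscale//.
  rewrite !integral_dirac// !diracT !mul1e subrr normr0 expr0n mule0 adde0.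
  by [].
have mg : measurable_fun [set: E]
    (fun y => (accept_prob a V q x y)%:E * (`|f y - f x| ^+ 2)%:E).
  apply: emeasurable_funM => //; apply/measurable_EFinP.
  exact: (measurableT_comp (measurable_accept_prob V) (pair1_measurable x)).
rewrite (@ge0_integral_density _ _ _ (lebesgue_rV n)
  (proposal_measure q x) (q x))//.
- by move=> y; exact/ltW/proposal_gt0.
- exact: measurable_proposalr.
- by move=> y; rewrite mule_ge0.
Qed.

End sampler_integrals.

(** * The Gibbs measure through its Lebesgue density *)

Section gibbs_integrals.
Context {R : realType} {n : nat}.
Local Notation E := 'rV[R]_n.
Local Open Scope ereal_scope.

Lemma measurable_expRN (V : {mfun E >-> R}) :
  measurable_fun [set: E] (fun x => (expR (- V x))%R).
Proof. by apply: measurableT_comp => //; exact: measurableT_comp. Qed.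

Lemma le_boltzmann {U V : {mfun E >-> R}} {m : R}
    (mUV : forall x, (m <= V x - U x)%R) {A : set E} (mA : measurable A) :
  boltzmann V A <= (expR (- m))%:E * boltzmann U A.
Proof.
have mexp (W : {mfun E >-> R}) :
    measurable_fun A (fun x => (expR (- W x))%:E).
  by apply/measurable_EFinP/measurable_funTS; exact: (measurable_expRN W).
have exp0 (W : E -> R) x : 0 <= (expR (- W x))%:E by rewrite lee_fin expR_ge0.
rewrite /boltzmann -ge0_integralZl// ?lee_fin ?expR_ge0//.
apply: ge0_le_integral => //.
- exact: measurable_funeM (mexp U).
- move=> x _; rewrite -EFinM lee_fin -expRD ler_expR.
  by have := mUV x; lra.
Qed.

(* The density of [q x] has integral one, so Lebesgue measure is not null. *)
Lemma boltzmann_gt0 (q : proposal R n) (V : {mfun E >-> R}) :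
  0 < boltzmann V [set: E].
Proof.
rewrite lt_def measure_ge0 andbT; apply/eqP => V0.
have mq : measurable_fun [set: E] (fun y => (q 0%R y)%:E).
  by apply/measurable_EFinP; exact: measurable_proposalr.
have mV : measurable_fun [set: E] (fun x => (expR (- V x))%:E).
  by apply/measurable_EFinP; exact: measurable_expRN.
have ae0 : ae_eq (lebesgue_rV n) [set: E] (fun x => (expR (- V x))%:E) (cst 0).
  apply/ae_eq_integral_abs => //; rewrite -[RHS]V0.
  by apply: eq_integral => x _; rewrite gee0_abs// lee_fin expR_ge0.
(* The exponential vanishes nowhere, so [ae0] makes the whole space null; then [q 0] is almost
   everywhere zero, against its integral being one. *)
have : \int[lebesgue_rV n]_y (q 0%R y)%:E = \int[lebesgue_rV n]_y cst 0 y.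
  apply: ae_eq_integral => //; apply: filterS ae0 => x /(_ I) /eqP.
  by rewrite eqe gt_eqF// expR_gt0.
by rewrite proposal_int1 integral0 => /eqP; rewrite onee_eq0.
Qed.

Section gibbs_density.
Variables (q : proposal R n) (V : {mfun E >-> R}).
Hypothesis V_fin : boltzmann V [set: E] < +oo.

Definition gibbs_density (x : E) : R :=
  (expR (- V x) / fine (boltzmann V [set: E]))%R.

Lemma gibbs_density_ge0 x : (0 <= gibbs_density x)%R.
Proof. by rewrite divr_ge0 ?expR_ge0// fine_ge0// measure_ge0. Qed.

Lemma measurable_gibbs_density : measurable_fun [set: E] gibbs_density.
Proof. by apply: measurable_funM => //; exact: measurable_expRN. Qed.

(** [mnormalize] returns its default Dirac mass when the total mass is zero or infinite. The first
    case is excluded by [boltzmann_gt0], which is where [q] enters, the second by [V_fin]. *)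
Lemma gibbsE (A : set E) : measurable A ->
  gibbs V A = \int[lebesgue_rV n]_(x in A) (gibbs_density x)%:E.
Proof.
move=> mA; rewrite /gibbs /= /mnormalize gt_eqF ?(boltzmann_gt0 q)//=.
rewrite lt_eqF//= /gibbs_density.
under eq_integral do rewrite EFinM.
rewrite ge0_integralZr//.
- by apply/measurable_EFinP/measurable_funTS; exact: measurable_expRN.
- by rewrite lee_fin invr_ge0 fine_ge0// measure_ge0.
Qed.

Lemma integral_gibbs {f : E -> \bar R} (f0 : forall x, 0 <= f x)
    (mf : measurable_fun [set: E] f) :
  \int[gibbs V]_x f x = \int[lebesgue_rV n]_x (f x * (gibbs_density x)%:E).
Proof.
apply: ge0_integral_density => //; first exact: gibbs_density_ge0.
- exact: measurable_gibbs_density.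
- exact: gibbsE.
Qed.

(** With Lebesgue measure in both variables, the potential enters only through the flux in the
    integrand, so two potentials can be compared pointwise. *)
Lemma gibbs_dirichletE (a : acceptance) {f : E -> R}
    (mf : measurable_fun [set: E] f) :
  \int[gibbs V]_x \int[transition a V q x]_y (`|f y - f x| ^+ 2)%:E =
  \int[lebesgue_rV n]_x \int[lebesgue_rV n]_y
    (gibbs_density x * q x y * accept_prob a V q x y * `|f y - f x| ^+ 2)%:E.
Proof.
have mk : measurable_fun [set: E * E] (fun z =>
    (accept_prob a V q z.1 z.2 * `|f z.2 - f z.1| ^+ 2 * q z.1 z.2)%:E).
  apply/measurable_EFinP; apply: measurable_funM.
    apply: measurable_funM; first exact: measurable_accept_prob.
    exact: measurable_sqr_increment.
  exact: measurable_proposal.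
have k0 x y :
    0 <= (accept_prob a V q x y * `|f y - f x| ^+ 2 * q x y)%:E.
  rewrite lee_fin !mulr_ge0 ?sqr_ge0//; first exact: acceptance_fun_ge0.
  exact/ltW/proposal_gt0.
under eq_integral do rewrite integral_transition_sqr_increment//.
rewrite integral_gibbs.
- apply: eq_integral => x _; rewrite -ge0_integralZr//.
  + by apply: eq_integral => y _; rewrite -EFinM; congr EFin; ring.
  + exact: (measurableT_comp mk (pair1_measurable x)).
  + by rewrite lee_fin gibbs_density_ge0.
- by move=> x; apply: integral_ge0.
- exact: (measurable_fun_fubini_tonelli_F (m2 := lebesgue_rV n) _ mk).
Qed.

End gibbs_density.
End gibbs_integrals.

(** * Second moments and variance *)

Section second_moment.
Local Open Scope ereal_scope.

Lemma Lfun2P {d} {T : measurableType d} {R : realType}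
    (mu : {measure set T -> \bar R}) (f : T -> R) :
  f \in Lfun mu 2%:E <->
  measurable_fun [set: T] f /\ \int[mu]_x (f x ^+ 2)%:E < +oo.
Proof.
split=> [f2|[mf f2]].
  split; first by have /andP[/[!inE]] := f2.
  have /integrableP[_] := Lfun2_integrable_sqr f2.
  by under eq_integral do rewrite /= ger0_norm ?sqr_ge0//.
apply/andP; split; rewrite inE//= /finite_norm unlock poweR_lty//.
rewrite (eq_integral (fun x => (f x ^+ 2)%:E))// => x _ /=.
by rewrite powR_mulrn// real_normK ?num_real.
Qed.

(** The variance is unchanged when [c] is subtracted from [f], and it is the second moment of
    [f - c] minus the square of its mean. *)
Lemma variance_le_sqr_dist {d} {T : measurableType d} {R : realType}
    (P : probability T R) {f : T -> R} (f2 : f \in Lfun P 2%:E) (c : R) :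
  'V_P[f] <= \int[P]_x ((f x - c) ^+ 2)%:E.
Proof.
have fc2 : (f \- cst c)%R \in Lfun P 2%:E.
  by rewrite rpredB ?lee1n//= => _; exact: Lfun_cst.
rewrite -(varianceB_cst_r c f2) varianceE// unlock.
rewrite [leRHS](_ : _ = \int[P]_x (((f \- cst c) ^+ 2)%R x)%:E); last first.
  by apply: eq_integral => x _; rewrite !expr2.
by rewrite geeDl// oppe_le0 sqre_ge0.
Qed.

Lemma variance_int {d} {T : measurableType d} {R : realType}
    (P : probability T R) (f : T -> R) :
  'V_P[f] = \int[P]_x ((f x - fine 'E_P[f]) ^+ 2)%:E.
Proof.
rewrite /variance covariance.unlock expectation.unlock.
by apply: eq_integral => x _; rewrite expr2.
Qed.

End second_moment.

(** * Gibbs measures and Dirichlet forms of two potentials with bounded difference *)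

Section gap_comparison.
Context {R : realType} {n : nat}.
Local Notation E := 'rV[R]_n.
Local Open Scope ereal_scope.
Context (a : acceptance) (q : proposal R n) {U V : {mfun E >-> R}} {m M : R}.
Hypothesis mUV : forall x, (m <= V x - U x)%R.
Hypothesis UVM : forall x, (V x - U x <= M)%R.
Hypothesis U_fin : boltzmann U [set: E] < +oo.

Lemma boltzmann_fin : boltzmann V [set: E] < +oo.
Proof.
apply: le_lt_trans (le_boltzmann mUV measurableT) _.
by rewrite lte_mul_pinfty// lee_fin expR_ge0.
Qed.

(** The upper bound [M] enters here: it gives [U - V >= -M], hence [le_boltzmann] with the two
    potentials exchanged. *)
Lemma le_inv_boltzmann :
  ((fine (boltzmann V [set: E]))^-1 <=
   expR M * (fine (boltzmann U [set: E]))^-1)%R.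
Proof.
have U0 : (0 < fine (boltzmann U [set: E]))%R.
  by rewrite fine_gt0// (boltzmann_gt0 q).
have V0 : (0 < fine (boltzmann V [set: E]))%R.
  by rewrite fine_gt0// (boltzmann_gt0 q) boltzmann_fin.
rewrite -ler_pdivrMl ?expR_gt0// -invfM lef_pV2 ?posrE ?mulr_gt0 ?expR_gt0//.
rewrite -lee_fin EFinM !fineK ?ge0_fin_numE ?measure_ge0//; last first.
  exact: boltzmann_fin.
rewrite -[M]opprK; apply: le_boltzmann => // x.
by have := UVM x; lra.
Qed.

(** The weights contribute [exp(-m)] and the normalizing constants [exp(M)]. Taking [u = v = 1]
    compares densities; taking proposal density times acceptance probability compares fluxes. *)
Lemma le_gibbs_density_mul (x : E) (u v : R) : (0 <= u)%R ->
  (expR (- V x) * v <= expR (- m) * (expR (- U x) * u))%R ->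
  (gibbs_density V x * v <= expR (M - m) * (gibbs_density U x * u))%R.
Proof.
move=> u0 uv; rewrite /gibbs_density mulrAC.
rewrite (le_trans (ler_wpM2r _ uv)) ?invr_ge0 ?fine_ge0 ?measure_ge0//.
apply: le_trans (ler_wpM2l _ le_inv_boltzmann) _.
  by rewrite !mulr_ge0 ?expR_ge0.
by rewrite expRD le_eqVlt; apply/orP; left; apply/eqP; ring.
Qed.

Lemma le_integral_gibbs {f : E -> \bar R} (f0 : forall x, 0 <= f x)
    (mf : measurable_fun [set: E] f) :
  \int[gibbs V]_x f x <= (expR (M - m))%:E * \int[gibbs U]_x f x.
Proof.
have md (W : {mfun E >-> R}) :
    measurable_fun [set: E] (fun x => f x * (gibbs_density W x)%:E).
  apply: emeasurable_funM => //; apply/measurable_EFinP.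
  exact: measurable_gibbs_density.
rewrite !(integral_gibbs q)//; last exact: boltzmann_fin.
rewrite -ge0_integralZl//; last first.
  by move=> x _; rewrite mule_ge0// lee_fin gibbs_density_ge0.
apply: ge0_le_integral => //.
- by move=> x _; rewrite mule_ge0// lee_fin gibbs_density_ge0.
- by apply: measurable_funeM; exact: md.
- move=> x _; rewrite muleCA lee_wpmul2l// -EFinM lee_fin.
  have := @le_gibbs_density_mul x 1%R 1%R ler01; rewrite !mulr1; apply.
  by rewrite -expRD ler_expR; have := mUV x; lra.
Qed.

(** Density and acceptance probability are compared together, as a flux. Bounding them separately
    would cost [exp(M - m)] twice. *)
Lemma le_gibbs_dirichlet {f : E -> R} (mf : measurable_fun [set: E] f) :
  \int[gibbs V]_x \int[transition a V q x]_y (`|f y - f x| ^+ 2)%:E <=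
  (expR (M - m))%:E *
    \int[gibbs U]_x \int[transition a U q x]_y (`|f y - f x| ^+ 2)%:E.
Proof.
pose k (W : {mfun E >-> R}) (z : E * E) : \bar R :=
  (gibbs_density W z.1 * q z.1 z.2 * accept_prob a W q z.1 z.2 *
   `|f z.2 - f z.1| ^+ 2)%:E.
have k0 W z : 0 <= k W z.
  rewrite lee_fin mulr_ge0 ?sqr_ge0//.
  apply: mulr_ge0; last exact: acceptance_fun_ge0.
  by rewrite mulr_ge0 ?gibbs_density_ge0// ltW// proposal_gt0.
have mk (W : {mfun E >-> R}) : measurable_fun [set: E * E] (k W).
  apply/measurable_EFinP; apply: measurable_funM; last first.
    exact: measurable_sqr_increment.
  apply: measurable_funM; last exact: measurable_accept_prob.
  apply: measurable_funM; last exact: measurable_proposal.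
  exact: (measurableT_comp (measurable_gibbs_density W) measurable_fst).
have mkx (W : {mfun E >-> R}) x : measurable_fun [set: E] (fun y => k W (x, y)).
  exact: (measurableT_comp (mk W) (pair1_measurable x)).
have mK (W : {mfun E >-> R}) : measurable_fun [set: E]
    (fun x => \int[lebesgue_rV n]_y k W (x, y)).
  exact: (measurable_fun_fubini_tonelli_F (m2 := lebesgue_rV n) _ (mk W)).
have C0 : 0 <= (expR (M - m))%:E by rewrite lee_fin expR_ge0.
rewrite !(gibbs_dirichletE q)//; last exact: boltzmann_fin.
rewrite -ge0_integralZl//; last 2 first.
- exact: (mK U).
- by move=> x _; apply: integral_ge0 => y _; exact: (k0 U (x, y)).
apply: ge0_le_integral => //.
- by move=> x _; apply: integral_ge0 => y _; exact: (k0 V (x, y)).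
- exact: (mK V).
- by apply: measurable_funeM; exact: (mK U).
move=> x _; rewrite -ge0_integralZl//; last 2 first.
- exact: (mkx U).
- by move=> y _; exact: (k0 U (x, y)).
apply: ge0_le_integral => //.
- by move=> y _; exact: (k0 V (x, y)).
- exact: (mkx V).
- by apply: measurable_funeM; exact: (mkx U).
move=> y _; rewrite -EFinM lee_fin [leRHS]mulrA ler_wpM2r ?sqr_ge0//.
have qacc0 : (0 <= q x y * accept_prob a U q x y)%R.
  rewrite mulr_ge0//; first exact/ltW/proposal_gt0.
  exact: acceptance_fun_ge0.
have := @le_gibbs_density_mul x _ (q x y * accept_prob a V q x y)%R qacc0.
rewrite !mulrA; apply.
by have := le_accept_prob a q mUV x y; rewrite !mulrA.
Qed.

(** The two gaps are infima over different [L^2] spaces; this transfers test functions from one to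
    the other. *)
Lemma Lfun2_gibbs {f : E -> R} :
  f \in Lfun (gibbs U) 2%:E -> f \in Lfun (gibbs V) 2%:E.
Proof.
move=> fU; have [mf f2] := (Lfun2P (gibbs U) f).1 fU.
apply: (Lfun2P (gibbs V) f).2; split; first exact: mf.
have f0 x : 0 <= (f x ^+ 2)%:E by rewrite lee_fin sqr_ge0.
have mf2 : measurable_fun [set: E] (fun x => (f x ^+ 2)%:E).
  by apply/measurable_EFinP; exact: measurable_funX.
apply: le_lt_trans (le_integral_gibbs f0 mf2) _.
by rewrite lte_mul_pinfty// lee_fin expR_ge0.
Qed.

Lemma le_variance_gibbs {f : E -> R} : f \in Lfun (gibbs U) 2%:E ->
  'V_(gibbs V)[f] <= (expR (M - m))%:E * 'V_(gibbs U)[f].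
Proof.
move=> f2; have [mf _] := (Lfun2P (gibbs U) f).1 f2.
(* The constant is the mean under [gibbs U], so that changing the measure to [gibbs U] yields
   exactly the variance there. *)
apply: le_trans (variance_le_sqr_dist _ (Lfun2_gibbs f2) (fine 'E_(gibbs U)[f])) _.
rewrite (variance_int (gibbs U)).
apply: (@le_integral_gibbs (fun x => ((f x - fine 'E_(gibbs U)[f]) ^+ 2)%:E)).
- by move=> x; rewrite lee_fin sqr_ge0.
- by apply/measurable_EFinP/measurable_funX; exact: measurable_funB.
Qed.

End gap_comparison.

(** * Comparison of the spectral gaps *)

Section spectral_gap_comparison.
Context {R : realType} {n : nat}.
Local Notation E := 'rV[R]_n.
Local Open Scope ereal_scope.

Lemma le_spectral_gap (a : acceptance) (q : proposal R n)
    (U V : {mfun E >-> R}) (m M : R)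
    (mUV : forall x, (m <= V x - U x)%R) (UVM : forall x, (V x - U x <= M)%R)
    (U_fin : boltzmann U [set: E] < +oo) :
  spectral_gap (gibbs V) (transition a V q) <=
  (expR (3 * (M - m)))%:E * spectral_gap (gibbs U) (transition a U q).
Proof.
have MVU x : (- M <= U x - V x)%R by have := UVM x; lra.
have VUm x : (U x - V x <= - m)%R by have := mUV x; lra.
have V_fin := boltzmann_fin mUV U_fin.
rewrite /spectral_gap -ereal_inf_pZl ?expR_gt0//.
apply: le_ereal_inf_tmp => _ [_ [f [f2 varU_gt0] <-] <-].
have [mf _] := (Lfun2P (gibbs U) f).1 f2.
have f2V := Lfun2_gibbs q mUV UVM U_fin f2.
(* The variance sits in the denominator, so it is needed in the opposite direction: the potentials
   are exchanged and the bounds become [-M] and [-m]. This also makes the variance under [gibbs V]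
   positive. *)
have := le_variance_gibbs q MVU VUm V_fin f2V; rewrite [(- m - _)%R]addrC opprK.
move: varU_gt0.
rewrite -(fineK (variance_fin_num f2)) -(fineK (variance_fin_num f2V)).
set vU := fine _; set vV := fine _; rewrite -EFinM lte_fin lee_fin => vU0 vUV.
have vV0 : (0 < vV)%R.
  by rewrite -(pmulr_rgt0 _ (expR_gt0 (M - m))) (lt_le_trans vU0).
apply: ge_ereal_inf; exists ((\int[gibbs V]_x \int[transition a V q x]_y
    (`|f y - f x| ^+ 2)%:E) / (2%:E * (vV)%:E)).
  exists f; last by rewrite fineK// variance_fin_num.
  by split=> //; rewrite -(fineK (variance_fin_num f2V)) lte_fin.
rewrite -!EFinM !inver !gt_eqF ?mulr_gt0//.
have N0 W : 0 <= \int[gibbs W]_x \int[transition a W q x]_y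
    (`|f y - f x| ^+ 2)%:E.
  by apply: integral_ge0 => x _; apply: integral_ge0 => y _; rewrite lee_fin sqr_ge0.
apply: le_trans (lee_pmul (N0 V) _ (le_gibbs_dirichlet a q mUV UVM U_fin mf)
  (_ : _ <= (expR (M - m))%:E * (2 * vU)^-1%:E)) _.
- by rewrite lee_fin invr_ge0 mulr_ge0// ltW.
- rewrite -EFinM lee_fin -ler_pdivrMl ?expR_gt0// -invfM.
  rewrite lef_pV2 ?posrE ?mulr_gt0 ?expR_gt0//.
  by rewrite mulrCA ler_pM2l.
rewrite muleACA -EFinM; apply: lee_wpmul2r.
  by rewrite mule_ge0// lee_fin invr_ge0 mulr_ge0// ltW.
(* Numerator and denominator each gave [exp(M - m)]; the third factor is at least one because
   [m <= M], as seen at the point [0]. *)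
rewrite lee_fin -expRD ler_expR.
by have := mUV 0%R; have := UVM 0%R; lra.
Qed.

End spectral_gap_comparison.

(** * Oscillation bounds and the conclusion *)

Lemma osc_bounds {R : realType} {n : nat}
    {V1 : 'rV[R]_n * 'rV[R]_n -> R} (eps : R)
    (V1_bounded : exists M : R, forall z, `|V1 z| <= M) (x : 'rV[R]_n) :
  inf (range (fun x : 'rV[R]_n => V1 (x, eps^-1 *: x))) <=
    V1 (x, eps^-1 *: x) <=
  sup (range (fun x : 'rV[R]_n => V1 (x, eps^-1 *: x))).
Proof.
(* Real [sup] and [inf] take default values on unbounded sets; the bound [B] ensures that they are
   true bounds. *)
have [B V1B] := V1_bounded; apply/andP; split.
- apply: ge_inf; last by exists x.
  by exists (- B) => _ [y _ <-]; have /ler_normlP[] := V1B (y, eps^-1 *: y); lra.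
- apply: ub_le_sup; last by exists x.
  by exists B => _ [y _ <-]; have /ler_normlP[] := V1B (y, eps^-1 *: y).
Qed.

Theorem corollary2p2 (R : realType) (n : nat)
    (V0 : smoothFun 'rV[R]_n) (V1 : smoothFun ('rV[R]_n * 'rV[R]_n)%type)
    (V0_bounded_below : exists m : R, forall x, m <= V0 x)
    (V0_trapping : trapping V0)
    (V0_integrable : (lebesgue_rV n).-integrable [set: 'rV[R]_n]
                       (fun x => (expR (- V0 x))%:E))
    (V1_bounded : exists M : R, forall z, `|V1 z| <= M)
    (osc_V1_bounded : exists C : R, forall eps : R, 0 < eps -> osc V1 eps <= C)
    (a : acceptance) (q : proposal R n)
    (eps : R) (eps_gt0 : 0 < eps) :
  let Gap0 := spectral_gap (gibbs V0) (transition a V0 q) in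
  let Gapeps := spectral_gap (gibbs (multiscale V0 V1 eps))
                  (transition a (multiscale V0 V1 eps) q) in
  ((expR (- 3 * osc V1 eps))%:E * Gap0 <= Gapeps)%E /\
  (Gapeps <= (expR (3 * osc V1 eps))%:E * Gap0)%E.
Proof.
move=> Gap0 Gapeps.
have Z0_fin : (boltzmann V0 [set: 'rV[R]_n] < +oo)%E.
  have /integrableP[_] := V0_integrable; congr (_ < _)%E.
  by apply: eq_integral => x _; rewrite gee0_abs// lee_fin expR_ge0.
have W x := osc_bounds eps V1_bounded x.
set m := inf _ in W; set M := sup _ in W.
have mW x : m <= multiscale V0 V1 eps x - V0 x.
  by rewrite /multiscale addrAC subrr add0r; have /andP[] := W x.
have WM x : multiscale V0 V1 eps x - V0 x <= M.
  by rewrite /multiscale addrAC subrr add0r; have /andP[] := W x.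
have oscE : osc V1 eps = M - m by [].
(* The reversed difference [V0 - multiscale V0 V1 eps] lies between [-M] and [-m], an interval of
   the same width. *)
have oscNE : osc V1 eps = - m - - M by rewrite oscE; ring.
have Zeps_fin := boltzmann_fin mW Z0_fin.
split; last by rewrite oscE; exact: le_spectral_gap.
(* Moving the exponential across turns the lower bound into the upper bound with the potentials
   exchanged, for which [Zeps_fin] is the required finiteness. *)
rewrite mulNr expRN lee_pdivrMl ?expR_gt0// oscNE.
apply: le_spectral_gap => // x; first by rewrite lerNl opprB WM.
by rewrite lerNr opprB mW.
Qed.
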